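(* Let $n \geq 2$ and let $(T_1, X_1), (T_2, X_2), \dots, (T_n, X_n)$ be transformation monoids such that, for each $i$, $X_i$ is a finite set with at least two elements and $T_i$ is either the full transformation monoid on $X_i$ or the symmetric group on $X_i$. Set $\Omega_1 = X_1$ and $V_1 = T_1$. For $2 \leq i \leq n$, let $\Omega_i = X_i \times \Omega_{i-1}$ and let $V_i = T_i \operatorname{wr} V_{i-1}$ be the wreath product of $T_i$ by the transformation monoid $(V_{i-1}, \Omega_{i-1})$, acting on $\Omega_i$. Set $V = V_n$. Then $$\operatorname{rank}(V) = n + t,$$ where $t$ is the number of indices $i \in \{1,\dots,n\}$ for which $T_i$ is the full transformation monoid on $X_i$.
   Context: A transformation monoid $(R, X)$ is a monoid $R$ of maps $X \to X$, acting on $X$ on the right (written $x \mapsto xr$), whose identity element $e$ is the identity map. Wreath product: for transformation monoids $(S, Y)$ and $(R, X)$, $S \operatorname{wr} R$ (formed with respect to the action of $R$ on $X$) is the set of pairs $(b, r)$ with $b = (b_i)_{i \in X} \in S^X$ and $r \in R$, with multiplication $$((a_i)_{i\in X}, r)\,((b_i)_{i \in X}, t) = ((a_i b_{ir})_{i \in X}, rt).$$ It is a transformation monoid on $Y \times X$ via the right action $(y, x)\,((s_i)_{i \in X}, r) = (y s_x, x r)$. Rank: the rank of a semigroup $S$, $\operatorname{rank}(S)$, is the minimum cardinality of a generating set of $S$, i.e. of a subset $U \subseteq S$ such that every element of $S$ is a product of elements of $U$; if $S$ is a monoid, the identity is by convention regarded as the empty word. *)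

(* Defs.v *)
From HB Require Import structures.
From mathcomp Require Import all_boot.
From mathcomp Require Import boolp.

Set Implicit Arguments.
Unset Strict Implicit.
Unset Printing Implicit Defensive.

(* Not an HB join of monoidType and finType: Hierarchy Builder rejects it once
   finStarMonoidType is loaded. *)
Record finMonoid := FinMonoid {
  mcarrier :> finType;
  mone : mcarrier;
  mmul : Monoid.law mone
}.

Arguments mone {f}.
Arguments mmul {f}.

(* The identity of M is the empty product, so it never has to be in U. *)
Definition generates (M : finMonoid) (U : {set M}) : Prop :=
  forall x : M, exists s : seq M,
    {subset s <= U} /\ x = \big[mmul/mone]_(u <- s) u.

Definition rank (M : finMonoid) : nat :=
  #|[arg min_(U < [set: M] | `[< generates U >]) #|U| ]|.

Lemma generates_setT (M : finMonoid) : generates [set: M].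
Proof.
move=> x; exists [:: x]; rewrite big_seq1; split=> // y _.
exact: in_setT.
Qed.

Lemma rankP (M : finMonoid) :
  (exists2 U : {set M}, generates U & #|U| = rank M) /\
  (forall U : {set M}, generates U -> rank M <= #|U|).
Proof.
rewrite /rank; case: arg_minnP => [|U /asboolP genU minU].
  exact/asboolP/generates_setT.
by split=> [|W genW]; [exists U | apply/minU/asboolP].
Qed.

(* A transformation monoid (R, X): faithfulness identifies the elements of R
   with maps X -> X.  X is required to be nonempty so that S wr R is again
   faithful. *)
Record transMonoid := TransMonoid {
  pt : finType;
  tmon : finMonoid;
  tact : pt -> tmon -> pt;
  pt_gt0 : 0 < #|pt|;
  tact1 : forall x, tact x mone = x;
  tactM : forall x r t, tact x (mmul r t) = tact (tact x r) t;
  tact_faithful : forall r t, (forall x, tact x r = tact x t) -> r = t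
}.

Definition transf (R : transMonoid) (r : tmon R) : {ffun pt R -> pt R} :=
  [ffun x => tact x r].

Definition is_full (R : transMonoid) : bool :=
  [set transf r | r : tmon R] == setT.

Definition is_sym (R : transMonoid) : bool :=
  [set transf r | r : tmon R] == [set f : {ffun pt R -> pt R} | injectiveb f].

Section Wreath.
Variables S R : transMonoid.

Definition wreath : finType := ({ffun pt R -> tmon S} * tmon R)%type.

Definition wr_one : wreath := ([ffun _ => mone], mone).

Definition wr_mul (u v : wreath) : wreath :=
  ([ffun i => mmul (u.1 i) (v.1 (tact i u.2))], mmul u.2 v.2).

Lemma wr_mulA : associative wr_mul.
Proof.
move=> u v w; rewrite /wr_mul /= Monoid.mulmA; congr pair.
by apply/ffunP=> i; rewrite !ffunE tactM Monoid.mulmA.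
Qed.

Lemma wr_mul1l : left_id wr_one wr_mul.
Proof.
case=> b r; rewrite /wr_mul /= Monoid.mul1m; congr pair.
by apply/ffunP=> i; rewrite !ffunE tact1 Monoid.mul1m.
Qed.

Lemma wr_mul1r : right_id wr_one wr_mul.
Proof.
case=> b r; rewrite /wr_mul /= Monoid.mulm1; congr pair.
by apply/ffunP=> i; rewrite !ffunE Monoid.mulm1.
Qed.

HB.instance Definition _ :=
  Monoid.isLaw.Build wreath wr_one wr_mul wr_mulA wr_mul1l wr_mul1r.

Definition wr_mon : finMonoid := @FinMonoid wreath wr_one wr_mul.

Definition wr_pt : finType := (pt S * pt R)%type.

Definition wr_act (p : wr_pt) (u : wr_mon) : wr_pt :=
  (tact p.1 (u.1 p.2), tact p.2 u.2).

Lemma wr_pt_gt0 : 0 < #|wr_pt|.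
Proof. by rewrite card_prod muln_gt0 !pt_gt0. Qed.

Lemma wr_act1 p : wr_act p mone = p.
Proof. by case: p => y x; rewrite /wr_act /= ffunE !tact1. Qed.

Lemma wr_actM p u v : wr_act p (mmul u v) = wr_act (wr_act p u) v.
Proof. by case: p => y x; rewrite /wr_act /= ffunE !tactM. Qed.

Lemma wr_act_faithful u v : (forall p, wr_act p u = wr_act p v) -> u = v.
Proof.
case: u v => [a r] [b t] eq_act; have /card_gt0P[y0 _] := pt_gt0 S.
congr pair.
  by apply/ffunP=> x; apply: tact_faithful => y; case: (eq_act (y, x)).
by apply: tact_faithful => x; case: (eq_act (y0, x)).
Qed.

Definition wr : transMonoid :=
  TransMonoid wr_pt_gt0 wr_act1 wr_actM wr_act_faithful.

End Wreath.

(* Indices are shifted down by one: T 0, T 1, ... are T_1, T_2, ..., and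
   iter_wr T k is (V_(k+1), Omega_(k+1)). *)
Fixpoint iter_wr (T : nat -> transMonoid) (k : nat) : transMonoid :=
  if k is k'.+1 then wr (T k) (iter_wr T k') else T 0.

(* Main.v *)
(* Lower bound: in a finite monoid of maps a product is invertible only if all
   its factors are, so the invertible generators generate the group of units.
   The n level signs (the product of the signs of all components at one level)
   map this group onto C_2^n, which requires n generators.  Moreover, if an
   element fails to be invertible at level i only, so does its first
   non-invertible factor in any factorization, and this gives one further
   generator for each full T_i.

   Upper bound: Sym(X) is generated by a transposition t and an element q of odd
   order.  In T_i wr V, with V transitive, the base element equal to t at one
   point and to q at another splits by taking powers, and conjugation then moves
   t and q to every point; hence one generator per level suffices, with one more
   when T_i is full.  If |X_1| = 2 this starts from T_1 itself.  Otherwise it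
   starts from T_2 wr T_1, for which two generators have to produce all units: with p of
   odd order and u = (x1 x2) generating Sym(X_1), they are (t on F; p) and
   (t at x1, q at x3; u), where x3 is fixed by u and F is {x1} if p fixes x1,
   and all of X_1 (which then has odd size) if p is a full cycle. *)
Require Import Defs.
From mathcomp Require Import all_boot.
From mathcomp Require Import fingroup perm cyclic.
From mathcomp Require Import boolp.

Set Implicit Arguments.
Unset Strict Implicit.
Unset Printing Implicit Defensive.

(** * Generators of the symmetric group, one of them of odd order *)

Lemma cycle_perm (X : finType) (s : seq X) : uniq s ->
  exists p : {perm X}, [/\ #[p]%g %| size s, {in [predC s], p =1 id} &
    {in s &, forall x y, exists i, y = (p ^+ i)%g x}].
Proof.
move=> Us; pose p := perm (can_inj (prev_next Us)); exists p.
have pE n x : (p ^+ n)%g x = iter n (next s) x.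
  by rewrite permX; apply: eq_iter => y; rewrite permE.
have p_fix : {in [predC s], p =1 id}.
  by move=> x; rewrite inE permE next_nth => /negPf->.
split=> // [|x y xs ys].
  rewrite order_dvdn; apply/eqP/permP=> x; rewrite perm1.
  have [xs|xs] := boolP (x \in s); last by rewrite permX_fix ?p_fix.
  rewrite pE -(order_cycle (cycle_next Us) Us xs).
  by rewrite (iter_order_cycle (cycle_next Us)).
exists (findex (next s) x y); rewrite pE iter_findex //.
by rewrite (fconnect_cycle (cycle_next Us) xs).
Qed.

(** Fix a point [c]. Of [X] and [X] without [c], exactly one has odd size; [p] is a full cycle on
    that one, and [x1] is [c]. The final disjunction records which case occurs, because [wr_two_gen]
    treats the two differently. *)
Lemma sym_gen (X : finType) : 1 < #|X| ->
  exists (x1 x2 : X) (p : {perm X}),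
  [/\ x1 != x2, odd #[p]%g, <<[set tperm x1 x2; p]>>%g = [set: {perm X}] &
      p x1 = x1 \/ [/\ odd #|X|, x2 = p x1 &
                       forall y, exists i, y = (p ^+ i)%g x1]].
Proof.
rewrite cardE; case def_s: (enum X) => [//|c s] /=; rewrite ltnS => s_gt0.
have: uniq (enum X) by apply: enum_uniq.
have in_s x : x \in c :: s by rewrite -def_s mem_enum.
rewrite {}def_s => Ucs; have /andP[cNs Us] := Ucs.
(* The transpositions [tperm c y] generate the symmetric group, so it is enough to reach each of
   them. *)
have star (a : X) (p : {perm X}) :
    (forall y, y != c -> tperm c y \in <<[set tperm c a; p]>>%g) ->
    <<[set tperm c a; p]>>%g = [set: {perm X}].
  move=> Hp; apply/eqP; rewrite eqEsubset subsetT -(gen_tperm c) gen_subG.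
  apply/subsetP=> _ /imsetP[y _ ->]; have [->|/Hp //] := eqVneq y c.
  by rewrite tperm1 group1.
have tp a p : tperm c a \in <<[set tperm c a; p]>>%g.
  by rewrite mem_gen // !inE eqxx.
have pp (a : X) (p : {perm X}) : p \in <<[set tperm c a; p]>>%g.
  by rewrite mem_gen // !inE eqxx orbT.
have [odd_s|even_s] := boolP (odd (size s)).
  have [p [p_s p_fix p_tr]] := cycle_perm Us.
  have [a as_] : exists a, a \in s.
    by case: (s) s_gt0 => // a s' _; exists a; rewrite mem_head.
  have pc : p c = c by apply: p_fix; rewrite inE.
  exists c, a, p; split; [| |apply: star => y yc|by left].
  - by apply: contraNneq cNs => ->.
  - exact: dvdn_odd p_s odd_s.
  have ys : y \in s by move: (in_s y); rewrite inE (negPf yc).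
  have [i ->] := p_tr _ _ as_ ys.
  have -> : tperm c ((p ^+ i)%g a) = (tperm c a ^ (p ^+ i))%g.
    by rewrite tpermJ (permX_fix _ pc).
  by rewrite groupJ ?groupX ?tp ?pp.
have [p [p_s _ p_tr]] := cycle_perm Ucs.
have {}p_tr y : exists i, y = (p ^+ i)%g c by apply: p_tr; rewrite ?mem_head.
have odd_cs : odd (size (c :: s)) by rewrite /=.
exists c, (p c), p; split; [| |apply: star => y _|by right].
- apply/eqP=> /esym pc; case: s s_gt0 cNs in_s p_tr {Us Ucs tp pp star p_s even_s odd_cs}.
    by [].
  move=> b s' _ cNs _ p_tr; have [i bE] := p_tr b.
  by move: cNs; rewrite inE negb_or [in X in X && _]bE permX_fix ?eqxx.
- exact: dvdn_odd p_s odd_cs.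
have [i ->] := p_tr y; elim: i => [|i IHi]; first by rewrite expg0 perm1 tperm1 group1.
rewrite expgSr permM; set d := (p ^+ i)%g c in IHi *.
have [->|d_c] := eqVneq d c; first exact: tp.
have [->|pd_c] := eqVneq (p d) c; first by rewrite tperm1 group1.
have pc_pd : p c != p d by rewrite (inj_eq perm_inj) eq_sym.
(* [tperm (p c) (p d)] is the conjugate by [p] of [tperm c d], known by induction; conjugating it by
   the given [tperm c (p c)] replaces [p c] by [c]. *)
have -> : tperm c (p d) = (tperm (p c) (p d) ^ tperm (p c) c)%g.
  by rewrite tpermJ_tperm // eq_sym.
by rewrite groupJ // -?tpermJ ?groupJ ?pp // tpermC tp.
Qed.

(** * Generation by closure, and generators of a single factor *)

Definition submonoid (M : finMonoid) (P : M -> Prop) : Prop :=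
  P mone /\ forall x y, P x -> P y -> P (mmul x y).

(** Stated through submonoid predicates instead of words, so that generation is proved by closure
    arguments alone; [rank_le_size] goes back to words. *)
Definition generated_by (M : finMonoid) (s : seq M) : Prop :=
  forall P : M -> Prop, submonoid P -> {in s, forall u, P u} -> forall x, P x.

Definition mexp (M : finMonoid) (x : M) (n : nat) : M := iter n (mmul x) mone.

Lemma submonoidX (M : finMonoid) (P : M -> Prop) x n :
  submonoid P -> P x -> P (mexp x n).
Proof. by case=> P1 PM Px; elim: n => [//|n IHn]; apply: PM. Qed.

Lemma rank_le_size (M : finMonoid) (s : seq M) : generated_by s -> rank M <= size s.
Proof.
move=> gen_s; have [_ /(_ [set u in s]) minU] := rankP M.
rewrite (leq_trans (minU _)) ?cardsE ?card_size // => x.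
pose P x := exists t : seq M,
  {subset t <= [set u in s]} /\ x = \big[mmul/mone]_(u <- t) u.
apply: (gen_s P) => [|u us].
  split=> [|_ _ [t [ts ->]] [t' [t's ->]]].
    by exists [::]; split=> //; rewrite big_nil.
  exists (t ++ t'); split; last by rewrite big_cat.
  by move=> u; rewrite mem_cat => /orP[/ts|/t's].
by exists [:: u]; rewrite big_seq1; split=> // v; rewrite !inE => /eqP->.
Qed.

(** Unique by faithfulness; the default [mone] is never reached when [T] is full or symmetric. *)
Definition of_perm (T : transMonoid) (p : {perm pt T}) : tmon T :=
  odflt mone [pick r | transf r == finfun p].

Lemma exists_transf (T : transMonoid) (f : {ffun pt T -> pt T}) :
  is_full T \/ is_sym T /\ injective f -> exists r : tmon T, transf r = f.
Proof.
move=> Tf; suff /imsetP[r _ ->] : f \in [set transf r | r : tmon T] by exists r.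
by case: Tf => [/eqP->|[/eqP-> /injectiveP]]; rewrite ?in_setT ?inE.
Qed.

Lemma of_permE (T : transMonoid) (p : {perm pt T}) x :
  is_full T \/ is_sym T -> tact x (of_perm p) = p x.
Proof.
move=> T_rich; rewrite /of_perm; case: pickP => [r /eqP/ffunP/(_ x)|noP].
  by rewrite !ffunE.
have [|r rp] := @exists_transf T (finfun p).
  case: T_rich => ?; [by left | right; split=> //].
  by move=> y z; rewrite !ffunE => /perm_inj.
by move: (noP r); rewrite rp eqxx.
Qed.

Section SymOrFull.

Variables (T : transMonoid) (T_rich : is_full T \/ is_sym T).

Let tact_of_perm (p : {perm pt T}) x : tact x (of_perm p) = p x := of_permE p x T_rich.

Lemma of_perm1 : of_perm 1 = mone :> tmon T.
Proof. by apply: tact_faithful => x; rewrite tact_of_perm perm1 tact1. Qed.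

Lemma of_permM (p q : {perm pt T}) : of_perm (p * q) = mmul (of_perm p) (of_perm q).
Proof.
by apply: tact_faithful => x; rewrite tactM !tact_of_perm permM.
Qed.

(** The permutations whose image satisfies [P] form a subgroup: in a finite group, closure under
    products and the identity suffice. *)
Lemma of_perm_gen (A : {set {perm pt T}}) (P : tmon T -> Prop) :
  <<A>>%g = [set: {perm pt T}] -> submonoid P ->
  {in A, forall p, P (of_perm p)} -> forall p, P (of_perm p).
Proof.
move=> genA [P1 PM] PA p; pose H := [set q : {perm pt T} | `[< P (of_perm q) >]].
have gH : group_set H.
  apply/group_setP; split=> [|q q']; first by rewrite inE of_perm1; apply/asboolP.
  by rewrite !inE => /asboolP Pq /asboolP Pq'; apply/asboolP; rewrite of_permM; apply: PM.
have: <<A>>%g \subset Group gH.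
  by rewrite gen_subG; apply/subsetP=> q Aq; rewrite inE; apply/asboolP/PA.
by rewrite genA => /subsetP/(_ p); rewrite !inE => /(_ isT)/asboolP.
Qed.

Lemma of_perm_inj (r : tmon T) : injective (fun x : pt T => tact x r) -> exists p, r = of_perm p.
Proof.
move=> r_inj; exists (perm r_inj).
by apply: tact_faithful => x; rewrite tact_of_perm permE.
Qed.

(** Induction on the number of points missed by [r]. If [r] identifies [a] and [b], it is the
    collapse of [a] to [b] followed by a map [s] that agrees with [r] off [a] and sends [a] to a
    missed point, so [s] misses fewer points. *)
Lemma full_gen (x1 x2 : pt T) (e : tmon T) (P : tmon T -> Prop) :
    is_full T -> x1 != x2 -> (forall x, tact x e = if x == x1 then x2 else x) ->
  submonoid P -> (forall p, P (of_perm p)) -> P e -> forall r, P r.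
Proof.
move=> T_full x1_x2 eE [P1 PM] Pp Pe.
have Pcollapse a b : a != b ->
    exists2 u, P u & forall x, tact x u = if x == a then b else x.
  (* [q] sends [a] to [x1] and [b] to [x2], so conjugating [e] by it gives the collapse of [a] to
     [b]. *)
  move=> a_b; pose q := (tperm a x1 * tperm (tperm a x1 b) x2)%g.
  have qa : q a = x1.
    rewrite permM tpermL tpermD // 1?eq_sym //.
    by rewrite -[X in X != _](tpermL a x1) (inj_eq perm_inj).
  have qb : q b = x2 by rewrite permM tpermL.
  exists (mmul (of_perm q) (mmul e (of_perm q^-1))) => [|x]; first exact: PM (Pp _) (PM _ _ Pe (Pp _)).
  rewrite !tactM !tact_of_perm eE -qa (inj_eq perm_inj) -qb.
  by case: eqP; rewrite permK.
move=> r; have [n] := ubnP #|~: [set tact x r | x : pt T]|.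
elim: n r => // n IHn r /ltnSE le_r_n.
have [/injectiveP r_inj|/injectivePn[a [b a_b rab]]] := boolP (injectiveb (fun x : pt T => tact x r)).
  by have [p ->] := of_perm_inj r_inj.
have [c cNr] : exists c, c \notin [set tact x r | x : pt T].
  apply/existsP; rewrite -negb_forall; apply: contra_neqN a_b => /forallP r_onto.
  suff /imset_injP/(_ a b) -> : #|[set tact x r | x : pt T]| == #|pt T| by rewrite ?inE.
  by rewrite -cardsT; apply/eqP/eq_card=> y; rewrite r_onto inE.
have [|s sE] := @exists_transf T [ffun x => if x == a then c else tact x r].
  by left.
have {}sE x : tact x s = if x == a then c else tact x r.
  by move/ffunP/(_ x): sE; rewrite !ffunE.
have [u Pu uE] := Pcollapse _ _ a_b.
have -> : r = mmul u s.
  apply: tact_faithful => x; rewrite tactM uE.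
  by have [->|xa] := eqVneq x a; rewrite sE ?(negPf xa) // eq_sym (negPf a_b).
apply: PM => //; apply: IHn; apply: leq_trans le_r_n; apply: proper_card.
apply/properP; split; last first.
  exists c; rewrite ?inE //= negbK.
  by apply/imsetP; exists a; rewrite // sE eqxx.
rewrite setCS; apply/subsetP=> _ /imsetP[x _ ->]; apply/imsetP.
have [->|xa] := eqVneq x a; last by exists x; rewrite // sE (negPf xa).
by exists b; rewrite // sE eq_sym (negPf a_b).
Qed.

(** The boolean [is_full T], read as 0 or 1, counts the extra generator, a map collapsing [x1] to
    [x2]. Otherwise the [nseq] is empty and [e] is a dummy. *)
Lemma factor_gen (x1 x2 : pt T) (A : {set {perm pt T}}) :
    x1 != x2 -> <<A>>%g = [set: {perm pt T}] ->
  exists e, generated_by ([seq of_perm p | p <- enum A] ++ nseq (is_full T) e).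
Proof.
move=> x1_x2 genA.
have [T_full|T_nfull] := boolP (is_full T); last first.
  exists mone => P Pm PA r; have T_sym : is_sym T.
    by case: T_rich => // T_full; rewrite T_full in T_nfull.
  have [|p ->] := @of_perm_inj r.
    have: transf r \in [set transf r | r : tmon T] by apply: imset_f.
    rewrite (eqP T_sym) inE => /injectiveP r_inj x y rxy.
    by apply: r_inj; rewrite !ffunE.
  apply: (of_perm_gen genA Pm) => q Aq; apply: PA.
  by rewrite mem_cat map_f // mem_enum.
have [|e eE] := @exists_transf T [ffun x => if x == x1 then x2 else x].
  by left.
exists e => P Pm PA; apply: (full_gen T_full x1_x2 (e := e)) => //.
- by move=> x; move/ffunP/(_ x): eE; rewrite !ffunE.
- apply: (of_perm_gen genA Pm) => q Aq; apply: PA.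
  by rewrite mem_cat map_f // mem_enum.
by apply: PA; rewrite mem_cat mem_head orbT.
Qed.

End SymOrFull.

(** * Generators of a wreath product, with parity arguments on supports *)

(** Read [E] as a family of subsets closed under symmetric difference and translation by [p].
    Telescoping along the cycle gives every pair {x, y}. Summing these over all y gives the
    complement of {x}, as [#|X|] is odd, and adding the whole set leaves {x}. *)
Lemma odd_singleton (X : finType) (E : (X -> bool) -> Prop) (p : {perm X}) (x : X) :
    (forall a b, E a -> E b -> E (fun i => a i (+) b i)) ->
    (forall a, E a -> E (fun i => a (p^-1 i)%g)) ->
    odd #|X| -> (forall y, exists i, y = (p ^+ i)%g x) ->
    E xpredT -> E (fun i => (i == x) (+) (i == p x)) -> E (pred1 x).
Proof.
move=> ED Ep oddX p_tr ET Exp.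
have EE a b : E a -> a =1 b -> E b by move=> Ea /funext <-.
have pair y : E (fun i => (i == x) (+) (i == y)).
  have [n ->] := p_tr y; elim: n => [|n IHn].
    by apply: EE (ED _ _ ET ET) _ => i /=; rewrite expg0 perm1 !addbb.
  apply: EE (ED _ _ Exp (Ep _ IHn)) _ => i /=.
  rewrite expgSr permM !(canF_eq (permKV p)) /=.
  by rewrite addbA -(addbA (i == x)) addbb addbF.
have sum (s : seq X) :
    E (fun i => odd (count_mem i s) (+) (i == x) && odd (size s)).
  elim: s => [|y s IHs].
    by apply: EE (ED _ _ ET ET) _ => i /=; rewrite andbF.
  apply: EE (ED _ _ (pair y) IHs) _ => i /=.
  rewrite oddD oddb [y == i]eq_sym.
  by case: (i == x); case: (i == y); case: odd; case: odd.
apply: EE (ED _ _ ET (sum (enum X))) _ => i /=.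
by rewrite count_uniq_mem ?enum_uniq // mem_enum inE -cardE oddX andbT /= negbK.
Qed.

Lemma tpermX_odd (X : finType) (x y : X) n :
  (tperm x y ^+ n)%g = (tperm x y ^+ odd n)%g.
Proof.
by rewrite -[in LHS](odd_double_half n) -mul2n expgD expgM expgS expg1 tperm2 expg1n mulg1.
Qed.

Section WreathGen.

Variables S R : transMonoid.

Definition wr_inr (r : tmon R) : wr_mon S R := ([ffun _ => mone], r).

Definition wr_delta (x : pt R) (s : tmon S) : wr_mon S R :=
  ([ffun i => if i == x then s else mone], mone).

Definition wr_perm (f : pt R -> {perm pt S}) (r : tmon R) : wr_mon S R :=
  ([ffun i => of_perm (f i)], r).

Lemma wr_monM (a b : {ffun pt R -> tmon S}) (r t : tmon R) :
  mmul ((a, r) : wr_mon S R) (b, t) = ([ffun i => mmul (a i) (b (tact i r))], mmul r t).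
Proof. by []. Qed.

Lemma wr_inrM r t : wr_inr (mmul r t) = mmul (wr_inr r) (wr_inr t).
Proof.
by rewrite wr_monM; congr pair; apply/ffunP=> i; rewrite !ffunE Monoid.mul1m.
Qed.

Lemma wr_deltaM x s t : wr_delta x (mmul s t) = mmul (wr_delta x s) (wr_delta x t).
Proof.
rewrite wr_monM Monoid.mul1m; congr pair; apply/ffunP=> i; rewrite !ffunE tact1.
by case: eqP; rewrite ?Monoid.mul1m.
Qed.

(** Transitivity of the group of units: in a finite monoid a right inverse is two-sided. *)
Definition invertibly_transitive (V : transMonoid) : Prop :=
  forall x y : pt V, exists r r' : tmon V, mmul r r' = mone /\ tact x r = y.

Lemma invertible_inj (V : transMonoid) (r r' : tmon V) :
  mmul r r' = mone -> injective (fun x : pt V => tact x r).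
Proof. by move=> rr' x y /(congr1 (fun z => tact z r')); rewrite -!tactM rr' !tact1. Qed.

(** Each generator of [S] is needed at one point only: conjugation by units of [R] carries it to all
    others, and (b, r) is a product of one-point elements followed by [wr_inr r]. *)
Lemma wr_submonoid_all (P : wr_mon S R -> Prop) (s : seq (tmon S)) :
    submonoid P -> invertibly_transitive R -> generated_by s ->
    (forall r, P (wr_inr r)) -> {in s, forall u, exists x, P (wr_delta x u)} ->
  forall u, P u.
Proof.
move=> [P1 PM] R_tr gen_s Pr Ps.
have Pdelta x : forall u, P (wr_delta x u).
  apply: gen_s => [|u /Ps[y Py]].
    split=> [|u v Pu Pv]; last by rewrite wr_deltaM; apply: PM.
    suff -> : wr_delta x mone = mone by [].
    by congr pair; apply/ffunP=> i; rewrite !ffunE if_same.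
  have [r [r' [rr' rxy]]] := R_tr x y.
  (* The component at [i] is [u] exactly when [r] sends [i] to [y], hence only for [i = x], as [r]
     is injective. *)
  suff -> : wr_delta x u = mmul (wr_inr r) (mmul (wr_delta y u) (wr_inr r')).
    by do 2?apply: (PM).
  rewrite !wr_monM Monoid.mul1m rr'; congr pair; apply/ffunP=> i.
  by rewrite !ffunE Monoid.mulm1 Monoid.mul1m -rxy (inj_eq (invertible_inj rr')).
case=> b r; have -> : ((b, r) : wr_mon S R) = mmul ((b, mone) : wr_mon S R) (wr_inr r).
  by rewrite wr_monM Monoid.mul1m; congr pair; apply/ffunP=> i; rewrite !ffunE Monoid.mulm1.
apply: (PM) => //; have: forall x, x \notin enum (pt R) -> b x = mone.
  by move=> x; rewrite mem_enum.
elim: (enum _) b => [|x l IHl] b b1.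
  suff -> : ((b, mone) : wr_mon S R) = mone by [].
  by congr pair; apply/ffunP=> i; rewrite ffunE b1.
have -> : ((b, mone) : wr_mon S R) =
    mmul (wr_delta x (b x)) ([ffun i => if i == x then mone else b i], mone).
  rewrite wr_monM Monoid.mul1m; congr pair; apply/ffunP=> i; rewrite !ffunE tact1.
  by case: eqP => [->|]; rewrite ?Monoid.mul1m ?Monoid.mulm1.
apply: (PM) => //; apply: IHl => i il; rewrite ffunE.
by case: eqP => // /eqP ix; apply: b1; rewrite inE negb_or ix.
Qed.

Hypothesis S_rich : is_full S \/ is_sym S.

Lemma wr_perm_ext f g r : f =1 g -> wr_perm f r = wr_perm g r.
Proof. by move=> fg; congr pair; apply/ffunP=> i; rewrite !ffunE fg. Qed.

Lemma wr_permM f g r t : 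
  mmul (wr_perm f r) (wr_perm g t) = wr_perm (fun i => f i * g (tact i r))%g (mmul r t).
Proof.
by rewrite wr_monM; congr pair; apply/ffunP=> i; rewrite !ffunE of_permM.
Qed.

Lemma wr_perm1X f n : mexp (wr_perm f mone) n = wr_perm (fun i => f i ^+ n)%g mone.
Proof.
elim: n => [|n IHn].
  by congr pair; apply/ffunP=> i; rewrite !ffunE of_perm1.
rewrite /mexp iterS -/(mexp _ n) IHn wr_permM Monoid.mul1m.
by apply: wr_perm_ext => i; rewrite tact1 expgS.
Qed.

Lemma wr_perm_inr r : wr_perm (fun _ => 1%g) r = wr_inr r.
Proof. by congr pair; apply/ffunP=> i; rewrite !ffunE of_perm1. Qed.

Lemma wr_perm_delta x q :
  wr_perm (fun i => if i == x then q else 1%g) mone = wr_delta x (of_perm q).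
Proof. by congr pair; apply/ffunP=> i; rewrite !ffunE; case: eqP; rewrite ?of_perm1. Qed.

Lemma wr_step (s : seq (tmon R)) :
    1 < #|pt S| -> 1 < #|pt R| -> invertibly_transitive R -> generated_by s ->
  exists2 s' : seq (tmon (wr S R)),
    generated_by s' & size s' = (size s).+1 + is_full S.
Proof.
move=> S_gt1 R_gt1 R_tr gen_s; have [y1 [y2 [q [y1_y2 q_odd gen_S _]]]] := sym_gen S_gt1.
have [e gen_e] := factor_gen S_rich y1_y2 gen_S.
have [x1 [x2 [_ _ x1_x2]]] := card_gt1P R_gt1.
pose t := tperm y1 y2.
pose w := wr_perm (fun i => if i == x1 then t else if i == x2 then q else 1)%g mone.
exists ([seq wr_inr u | u <- s] ++ w :: nseq (is_full S) (wr_delta x1 e)); last first.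
  by rewrite size_cat /= size_map size_nseq addnS.
move=> P Pm Pgen; have [P1 PM] := Pm.
have Pw : P w by apply: Pgen; rewrite mem_cat mem_head orbT.
apply: (wr_submonoid_all Pm R_tr gen_e).
  apply: gen_s => [|u us]; last by apply: Pgen; rewrite mem_cat map_f.
  by split=> // u v Pu Pv; rewrite wr_inrM; apply: PM.
move=> u; rewrite mem_cat => /orP[/mapP[p]|]; last first.
  rewrite mem_nseq => /andP[T_full /eqP->]; exists x1; apply: Pgen.
  by rewrite mem_cat inE mem_nseq T_full eqxx !orbT.
rewrite mem_enum !inE => /orP[]/eqP-> ->; [exists x1 | exists x2];
  rewrite -wr_perm_delta.
(* An odd exponent that kills [q] and keeps [t]. *)
- suff <- : mexp w #[q]%g = wr_perm (fun i => if i == x1 then t else 1)%g mone.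
    exact: submonoidX.
  rewrite wr_perm1X; apply: wr_perm_ext => i; case: eqP => _; first by rewrite tpermX_odd q_odd.
  by case: eqP; rewrite ?expg_order ?expg1n.
(* An even exponent that kills [t] and keeps [q]. *)
- suff <- : mexp w #[q]%g.+1 = wr_perm (fun i => if i == x2 then q else 1)%g mone.
    exact: submonoidX.
  rewrite wr_perm1X; apply: wr_perm_ext => i; have [->|_] := eqVneq i x1.
    by rewrite tpermX_odd /= q_odd expg0 (negPf x1_x2).
  by case: eqP; rewrite ?expgS ?expg_order ?mulg1 ?expg1n ?mulg1.
Qed.

End WreathGen.

(** * Transitivity, the two lowest levels, and the upper bound *)

Lemma rich_transitive (V : transMonoid) :
  is_full V \/ is_sym V -> invertibly_transitive V.
Proof.
move=> V_rich x y; exists (of_perm (tperm x y)), (of_perm (tperm x y)).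
by rewrite -of_permM // tperm2 of_perm1 // of_permE // tpermL.
Qed.

Lemma wr_transitive (S R : transMonoid) :
    is_full S \/ is_sym S -> invertibly_transitive R ->
  invertibly_transitive (wr S R).
Proof.
move=> S_rich R_tr [y x] [y' x']; have [r [r' [rr' rx]]] := R_tr x x'.
exists (wr_perm (fun _ => tperm y y') r), (wr_perm (fun _ => tperm y y') r').
split; last by rewrite /= /wr_act /= ffunE of_permE // tpermL rx.
by rewrite wr_permM // rr' tperm2 wr_perm_inr.
Qed.

Lemma wr_two_gen (S R : transMonoid) :
    is_full S \/ is_sym S -> is_full R \/ is_sym R ->
    1 < #|pt S| -> 2 < #|pt R| ->
  exists2 s : seq (tmon (wr S R)),
    generated_by s & size s = (is_full R + is_full S).+2.
Proof.
move=> S_rich R_rich S_gt1 R_gt2; have R_gt1 := ltnW R_gt2.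
have [y1 [y2 [q [y1_y2 q_odd gen_S _]]]] := sym_gen S_gt1.
have [x1 [x2 [p [x1_x2 p_odd gen_R p_cycle]]]] := sym_gen R_gt1.
have [eS gen_eS] := factor_gen S_rich y1_y2 gen_S.
have [eR gen_eR] := factor_gen R_rich x1_x2 gen_R.
have [x3 /norP[x3_x1 x3_x2]] : exists x3, ~~ ((x3 == x1) || (x3 == x2)).
  apply/existsP; rewrite -negb_forall; apply: contraL R_gt2 => /forallP all12.
  have /subset_leq_card : [set: pt R] \subset [set x1; x2].
    by apply/subsetP=> x _; rewrite !inE all12.
  by rewrite cardsT cards2 x1_x2 -leqNgt.
have neqF := (negPf x1_x2, negPf x3_x1, negPf x3_x2).
have {}neqF := (neqF, etrans (eq_sym x2 x1) (negPf x1_x2),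
  etrans (eq_sym x1 x3) (negPf x3_x1), etrans (eq_sym x2 x3) (negPf x3_x2)).
pose t := tperm y1 y2; pose u := tperm x1 x2.
have u3 : u x3 = x3 by rewrite tpermD // eq_sym.
pose wp f g : wr_mon S R := wr_perm f (of_perm g).
have wpM f g g1 g2 : mmul (wp f g1) (wp g g2) = wp (fun i => f i * g (g1 i))%g (g1 * g2)%g.
  by rewrite wr_permM // -of_permM //; apply: wr_perm_ext => i; rewrite of_permE.
have wpX f (g : {perm pt R}) n : (forall i, f (g i) = f i) ->
    mexp (wp f g) n = wp (fun i => f i ^+ n)%g (g ^+ n)%g.
  move=> fg; elim: n => [|n IHn]; first by rewrite /wp of_perm1 // wr_perm_inr.
  rewrite /mexp iterS -/(mexp _ n) IHn wpM expgS.
  by apply: wr_perm_ext => i; rewrite fg expgS.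
(* Indicator of the set F: {x1} if [p] fixes [x1], everything otherwise. It is invariant under [p],
   so powers of [w1] can be taken componentwise. *)
pose a0 i := (p x1 == x1) ==> (i == x1).
have a0p i : a0 (p i) = a0 i.
  by rewrite /a0; case: eqP => //= px1; rewrite -[in LHS]px1 (inj_eq perm_inj).
pose w1 := wp (fun i => t ^+ a0 i)%g p.
pose w2 := wp (fun i => if i == x1 then t else if i == x3 then q else 1)%g u.
exists (w1 :: w2 :: nseq (is_full R) (wr_inr S eR) ++ nseq (is_full S) (wr_delta x1 eS)).
  move=> P Pm Pgen; have [P1 PM] := Pm.
  have Pw1 : P w1 by apply: Pgen; rewrite mem_head.
  have Pw2 : P w2 by apply: Pgen; rewrite inE mem_head orbT.
  (* The supports on which [t] can be placed, with trivial top part, inside [P]. *)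
  pose E a := P (wp (fun i => t ^+ (a i : bool)) 1)%g.
  have Ea0 : E a0.
    rewrite /E; suff <- : mexp w1 #[p]%g = wp (fun i => t ^+ a0 i)%g 1%g by apply: submonoidX.
    rewrite wpX ?expg_order => [|i]; last by rewrite a0p.
    apply: wr_perm_ext => i.
    by case: (a0 i); rewrite ?expg1 ?expg0 ?expg1n // tpermX_odd p_odd.
  have Pp n : P (wp (fun _ => 1) (p ^+ n))%g.
    suff <- : mexp (mexp w1 #[p]%g.+1) n = wp (fun _ => 1)%g (p ^+ n)%g.
      by do 2?apply: submonoidX.
    have -> : mexp w1 #[p]%g.+1 = wp (fun _ => 1)%g p.
      rewrite wpX => [|i]; last by rewrite a0p.
      rewrite expgS expg_order mulg1; apply: wr_perm_ext => i.
      by case: (a0 i); rewrite ?expg1 ?expg0 ?expg1n // tpermX_odd /= p_odd.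
    by rewrite wpX //; apply: wr_perm_ext => i; rewrite expg1n.
  (* The square of [w2]: [u] swaps [x1] and [x2], so [t] appears once at each of them, while [q] is
     squared at the fixed point [x3]. *)
  pose v := wp (fun i => if (i == x1) (+) (i == x2) then t
                         else if i == x3 then q * q else 1)%g 1%g.
  have Pv : P v.
    suff -> : v = mmul w2 w2 by apply: PM.
    rewrite wpM tperm2; apply: wr_perm_ext => i.
    have [->|i1] := eqVneq i x1.
      by rewrite tpermL !neqF mulg1.
    have [->|i2] := eqVneq i x2.
      by rewrite tpermR eqxx !neqF mul1g.
    by rewrite tpermD 1?eq_sym // (negPf i1); case: eqP => _; rewrite ?mulg1.
  have Eu : E (fun i => (i == x1) (+) (i == x2)).
    rewrite /E; suff <- : mexp v #[q]%g = wp (fun i => t ^+ ((i == x1) (+) (i == x2)))%g 1%g.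
      exact: submonoidX.
    rewrite wpX => [|i]; last by rewrite perm1.
    rewrite expg1n; apply: wr_perm_ext => i; case: (_ (+) _).
      by rewrite tpermX_odd q_odd.
    by case: eqP; rewrite ?expgMn ?expg_order ?mulg1 ?expg1n.
  have Pq n : P (wp (fun i => if i == x3 then q ^+ n else 1) 1)%g.
    (* [m] is the inverse of 2 modulo the odd order of [q], so it undoes the squaring in [v]; the
       exponent [#[q].+1] has already removed [t]. *)
    pose m := uphalf #[q]%g.
    suff <- : mexp (mexp (mexp v #[q]%g.+1) m) n =
              wp (fun i => if i == x3 then q ^+ n else 1)%g 1%g.
      by do 3?apply: submonoidX.
    rewrite !wpX => [|i|i|i]; rewrite ?expg1n ?perm1 //.
    apply: wr_perm_ext => i.
    have [->|i3] := eqVneq i x3; last first.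
      by case: (_ (+) _); rewrite ?expg1n // tpermX_odd /= q_odd expg0 !expg1n.
    rewrite !neqF /= -expg2; congr (_ ^+ n)%g.
    rewrite expgS expgAC expg_order expg1n mulg1 -expgM mul2n odd_uphalfK //.
    by rewrite expgS expg_order mulg1.
  (* If [p] fixes [x1], this is [Ea0]. Otherwise F is the whole odd set and x2 = p x1, so [Eu] is
     the pair required by [odd_singleton]. *)
  have E1 : E (pred1 x1).
    case: p_cycle Ea0 Eu => [px1|[oddR x2E p_tr]]; first by rewrite /a0 px1 eqxx.
    have -> : a0 = xpredT.
      apply: funext => i; rewrite /a0; case: eqP => //= px1.
      by have [k ->] := p_tr i; rewrite permX_fix ?eqxx.
    rewrite x2E => ET Exp; apply: (odd_singleton (p := p)) => //.
    - move=> a b Ea Eb; rewrite /E.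
      suff <- : mmul (wp (fun i => t ^+ a i) 1)%g (wp (fun i => t ^+ b i) 1)%g =
                wp (fun i => t ^+ (a i (+) b i))%g 1%g by apply: PM.
      rewrite wpM mulg1; apply: wr_perm_ext => i; rewrite perm1.
      by case: (a i); case: (b i); rewrite ?expg1 ?expg0 ?mulg1 ?mul1g ?tperm2.
    - move=> a Ea; rewrite /E.
      suff <- : mmul (wp (fun _ => 1) (p ^+ #[p].-1))%g
                     (mmul (wp (fun i => t ^+ a i) 1) (wp (fun _ => 1) (p ^+ 1)))%g =
                wp (fun i => t ^+ a (p^-1 i))%g 1%g.
        by apply: (PM) => //; apply: PM.
      rewrite -invg_expg !wpM expg1 mul1g mulVg; apply: wr_perm_ext => i.
      by rewrite mul1g mulg1.

  (* Cancel the base part of [w2]: [t] at [x1] on the left, the inverse of [q] at [x3] on the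
     right. *)
  have Pu : P (wp (fun _ => 1) u)%g.
    suff -> : wp (fun _ => 1)%g u =
      mmul (wp (fun i => t ^+ (pred1 x1 i)) 1)%g
           (mmul w2 (wp (fun i => if i == x3 then q ^+ #[q].-1 else 1) 1)%g).
      exact: PM _ _ E1 (PM _ _ Pw2 (Pq _)).
    rewrite !wpM mul1g mulg1; apply: wr_perm_ext => i; rewrite perm1 /=.
    have [->|i1] := eqVneq i x1; first by rewrite tpermL !neqF mulg1 expg1 tperm2.
    rewrite expg0 mul1g; have [->|i3] := eqVneq i x3.
      by rewrite u3 eqxx -expgS prednK ?order_gt0 ?expg_order.
    by rewrite mul1g -[in u i == x3]u3 (inj_eq perm_inj) (negPf i3).
  have Pinr r : P (wr_inr S r).
    move: r; apply: gen_eR => [|r].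
      by split=> // r r' Pr Pr'; rewrite wr_inrM; apply: PM.
    rewrite mem_cat => /orP[/mapP[g]|rR]; last first.
      apply: Pgen; rewrite !inE mem_cat.
      by move: rR; rewrite !mem_nseq => /andP[-> /eqP->]; rewrite eqxx !orbT.
    rewrite mem_enum !inE => /orP[]/eqP-> ->; rewrite -wr_perm_inr //.
    by rewrite -[p]expg1; apply: Pp.
  apply: (wr_submonoid_all Pm (rich_transitive R_rich) gen_eS Pinr) => s.
  rewrite mem_cat => /orP[/mapP[g]|sS]; last first.
    exists x1; apply: Pgen; rewrite !inE mem_cat.
    by move: sS; rewrite !mem_nseq => /andP[-> /eqP->]; rewrite eqxx !orbT.
  rewrite mem_enum !inE => /orP[]/eqP-> ->; [exists x1|exists x3];
    rewrite -wr_perm_delta // -of_perm1 //.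
    by move: E1; rewrite /E; congr P; apply: wr_perm_ext => i /=; case: eqP.
  by move: (Pq 1); congr P; apply: wr_perm_ext => i /=; rewrite expg1.
by rewrite /= size_cat !size_nseq.
Qed.

(** On two points the only nontrivial [tperm x1 y] generates, so the first level costs a single
    permutation. *)
Lemma two_point_gen (X : finType) : #|X| = 2 ->
  exists (x1 x2 : X) (A : {set {perm X}}),
    [/\ x1 != x2, #|A| <= 1 & <<A>>%g = [set: {perm X}]].
Proof.
move=> X2; have /card_gt1P[x1 [x2 [_ _ x1_x2]]] : 1 < #|X| by rewrite X2.
exists x1, x2, [set tperm x1 y | y in X]^#%g; rewrite genD1id gen_tperm; split=> //.
have := leq_imset_card (tperm x1) X; rewrite X2 (cardsD1 1%g).
have -> // : 1%g \in [set tperm x1 y | y in X].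
by apply/imsetP; exists x1; rewrite ?tperm1.
Qed.

(** The guard excludes a single level with more than two points, whose symmetric group is not cyclic
    and where the bound fails; [wr_two_gen] recovers the bound at [k = 1]. *)
Lemma iter_wr_upper (T : nat -> transMonoid) (k : nat) :
    (forall i, i <= k -> 1 < #|pt (T i)|) ->
    (forall i, i <= k -> is_full (T i) \/ is_sym (T i)) ->
  [/\ 1 < #|pt (iter_wr T k)|, invertibly_transitive (iter_wr T k) &
      (0 < k) || (#|pt (T 0)| == 2) -> exists2 s : seq (tmon (iter_wr T k)),
        generated_by s & size s <= k.+1 + \sum_(i < k.+1) is_full (T i)].
Proof.
elim: k => [|k IHk] X_gt1 T_rich.
  have T0_rich := T_rich 0 isT; split=> /=; [exact: X_gt1 | exact: rich_transitive |].
  move/eqP=> /two_point_gen[x1 [x2 [A [x1_x2 A1 genA]]]].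
  have [e gen_e] := factor_gen T0_rich x1_x2 genA.
  exists ([seq of_perm p | p <- enum A] ++ nseq (is_full (T 0)) e) => //.
  by rewrite size_cat size_map size_nseq -cardE big_ord1 leq_add2r.
have [i le_ik|i le_ik|R_gt1 R_tr IH] := IHk; [exact/X_gt1/leqW | exact/T_rich/leqW |].
have S_rich := T_rich _ (leqnn k.+1); have S_gt1 := X_gt1 _ (leqnn k.+1).
split; [|exact: wr_transitive|move=> _].
  rewrite /= card_prod -[2]/(1 * 2) (leq_trans _ (leq_mul (ltnW S_gt1) R_gt1)) //.
have [/IH[s gen_s le_s]|] := boolP ((0 < k) || (#|pt (T 0)| == 2)).
  have [s' gen_s' sz_s'] := wr_step S_rich S_gt1 R_gt1 R_tr gen_s.
  by exists s' => //; rewrite sz_s' big_ord_recr /= addnA leq_add2r.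
rewrite negb_or -eqn0Ngt => /andP[/eqP k0 X0_neq2]; subst k.
have [|s gen_s sz_s] := wr_two_gen S_rich (T_rich 0 isT) S_gt1.
  by rewrite ltn_neqAle eq_sym X0_neq2 X_gt1.
by exists s => //; rewrite sz_s big_ord_recr big_ord1.
Qed.

(** * Units, and the sign and singularity of each level *)

Section Invertible.

Variable V : transMonoid.

(** Injectivity of the action describes the units: a permutation in a finite monoid has its inverse
    among its powers. *)
Definition invertible (r : tmon V) : bool := injectiveb (fun x : pt V => tact x r).

Lemma invertibleP r : reflect (injective (fun x : pt V => tact x r)) (invertible r).
Proof. exact: injectiveP. Qed.

Lemma invertible1 : invertible mone.
Proof. by apply/invertibleP=> x y; rewrite !tact1. Qed.

Lemma invertibleM r t : invertible (mmul r t) = invertible r && invertible t.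
Proof.
apply/invertibleP/andP=> [rt_inj|[/invertibleP r_inj /invertibleP t_inj] x y].
  have r_inj : injective (fun x : pt V => tact x r).
    by move=> x y rxy; apply: rt_inj; rewrite !tactM rxy.
  split; apply/invertibleP=> // x y txy.
  rewrite -(f_invF r_inj x) -(f_invF r_inj y); congr tact.
  by apply: rt_inj; rewrite !tactM !(f_invF r_inj).
by rewrite !tactM => /t_inj/r_inj.
Qed.

Definition to_perm (r : tmon V) : {perm pt V} :=
  odflt 1%g [pick p : {perm pt V} | [forall x, p x == tact x r]].

Lemma to_permE r x : invertible r -> to_perm r x = tact x r.
Proof.
move/invertibleP=> r_inj; rewrite /to_perm; case: pickP => [p /forallP/(_ x)/eqP //|].
by move/(_ (perm r_inj))/negbT/forallPn=> [y]; rewrite permE eqxx.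
Qed.

Lemma to_permM r t : invertible r -> invertible t ->
  to_perm (mmul r t) = (to_perm r * to_perm t)%g.
Proof.
move=> r_inv t_inv; apply/permP=> x.
by rewrite permM !to_permE ?tactM // invertibleM r_inv.
Qed.

Lemma of_permK : is_full V \/ is_sym V -> forall p : {perm pt V},
  invertible (of_perm p) /\ to_perm (of_perm p) = p.
Proof.
move=> V_rich p; have p_inv : invertible (of_perm p).
  by apply/invertibleP=> x y; rewrite !of_permE // => /perm_inj.
by split=> //; apply/permP=> x; rewrite to_permE ?of_permE.
Qed.

Lemma full_noninvertible : is_full V -> 1 < #|pt V| -> exists r, ~~ invertible r.
Proof.
move=> V_full /card_gt1P[x [y [_ _ x_y]]].
have [|r rE] := @exists_transf V [ffun _ => x]; first by left.
exists r; apply: contraNN x_y => /invertibleP r_inj; apply/eqP/r_inj.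
by move/ffunP: rE => rE; move: (rE x) (rE y); rewrite !ffunE => -> ->.
Qed.

End Invertible.

Lemma invertible_wr (S R : transMonoid) (u : tmon (wr S R)) :
  invertible u = invertible u.2 && [forall x, invertible (u.1 x)].
Proof.
apply/invertibleP/andP=> [u_inj|[/invertibleP u2_inj /forallP u1_inj]].
  have u1_inj x : invertible (u.1 x).
    apply/invertibleP=> y y' uyy'.
    by have := u_inj (y, x) (y', x); rewrite /= /wr_act /= uyy' => /(_ erefl) [].
  split; last exact/forallP.
  apply/invertibleP=> x x' uxx'; have /card_gt0P[y _] := pt_gt0 S.
  have /invertibleP fx' := u1_inj x'.
  (* If [x] and [x'] have the same image, surjectivity of the component at [x'] yields a point over
     [x'] with the same image as (y, x). *)
  have := u_inj (y, x) (invF fx' (tact y (u.1 x)), x').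
  by rewrite /= /wr_act /= uxx' (f_invF fx') => /(_ erefl) [].
case=> y x [y' x']; rewrite /= /wr_act /= => -[uyy' /u2_inj x_x'].
move: uyy'; rewrite -{}x_x' => uyy'; congr pair.
by have /invertibleP := u1_inj x; apply.
Qed.

Fixpoint level_sign (T : nat -> transMonoid) (k i : nat) : tmon (iter_wr T k) -> bool :=
  match k return tmon (iter_wr T k) -> bool with
  | 0 => fun r => odd_perm (to_perm r)
  | k'.+1 => fun u =>
      if i == k'.+1 then \big[addb/false]_x odd_perm (to_perm (u.1 x))
      else level_sign i u.2
  end.

(* Non-invertible, but with a non-invertible component at level [i] only. *)
Fixpoint level_singular (T : nat -> transMonoid) (k i : nat) : tmon (iter_wr T k) -> bool :=
  match k return tmon (iter_wr T k) -> bool with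
  | 0 => fun r => ~~ invertible r
  | k'.+1 => fun u =>
      if i == k'.+1 then invertible u.2 && ~~ [forall x, invertible (u.1 x)]
      else level_singular i u.2 && [forall x, invertible (u.1 x)]
  end.

Section Levels.

Variable T : nat -> transMonoid.

Lemma level_signM k i (u v : tmon (iter_wr T k)) : invertible u -> invertible v ->
  level_sign i (mmul u v) = level_sign i u (+) level_sign i v.
Proof.
elim: k u v => [|k IHk] u v; first by move=> *; rewrite /= to_permM // odd_permM.
rewrite !invertible_wr => /andP[u2 /forallP u1] /andP[v2 /forallP v1] /=.
case: eqP => _; last exact: IHk.
(* The unit [u.2] merely permutes the components of [v], which does not affect the product of their
   signs. *)
rewrite [in X in _ (+) X](reindex_inj (invertibleP _ u2)) -big_split /=.
by apply: eq_bigr => x _; rewrite ffunE to_permM // odd_permM.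
Qed.

(** At each level independently, place a transposition or the identity at one point and the identity
    elsewhere. *)
Lemma level_sign_onto k (c : nat -> bool) :
    (forall i, i <= k -> 1 < #|pt (T i)|) ->
    (forall i, i <= k -> is_full (T i) \/ is_sym (T i)) ->
  exists2 u : tmon (iter_wr T k), invertible u &
    forall i, i <= k -> level_sign i u = c i.
Proof.
have signed i : 1 < #|pt (T i)| -> is_full (T i) \/ is_sym (T i) ->
    exists2 r : tmon (T i), invertible r & odd_perm (to_perm r) = c i.
  move=> /card_gt1P[x [y [_ _ x_y]]] Ti.
  have [r_inv rK] := of_permK Ti (tperm x y ^+ c i)%g.
  exists (of_perm (tperm x y ^+ c i)%g) => //.
  by rewrite rK; case: (c i); rewrite ?expg1 ?expg0 ?odd_tperm ?odd_perm1.
elim: k => [|k IHk] X_gt1 T_rich.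
  have [r r_inv r_c] := signed 0 (X_gt1 0 isT) (T_rich 0 isT).
  by exists r => // i; rewrite leqn0 => /eqP->.
have [i le_ik|i le_ik|u u_inv u_c] := IHk; [exact/X_gt1/leqW | exact/T_rich/leqW |].
have [r r_inv r_c] := signed k.+1 (X_gt1 _ (leqnn _)) (T_rich _ (leqnn _)).
have /card_gt0P[x0 _] := pt_gt0 (iter_wr T k).
have inv_x x : invertible (if x == x0 then r else mone).
  by case: eqP => // _; apply: invertible1.
exists ([ffun x => if x == x0 then r else mone], u).
  by rewrite invertible_wr u_inv; apply/forallP=> x; rewrite ffunE.
move=> i; rewrite leq_eqVlt => /predU1P[->|]; last first.
  by rewrite ltnS => le_ik /=; rewrite ltn_eqF ?u_c.
rewrite /= eqxx (bigD1 x0) //= ffunE eqxx r_c big1 ?addbF // => x x_x0.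
rewrite ffunE (negPf x_x0).
suff -> : to_perm (mone : tmon (T k.+1)) = 1%g by rewrite odd_perm1.
by apply/permP=> y; rewrite perm1 to_permE ?invertible1 ?tact1.
Qed.

Lemma level_singular_noninv k i (u : tmon (iter_wr T k)) :
  level_singular i u -> ~~ invertible u.
Proof.
elim: k u => [|k IHk] u //=; rewrite (invertible_wr u) negb_and.
by case: eqP => _ /andP[u2 u1]; rewrite ?u1 ?orbT ?IHk.
Qed.

(** The conditional selects the first non-invertible factor when a word is read from the left. A
    unit [u] only permutes the components of [v]; a non-unit [u] cannot fail at another level, since
    the product would fail there too. *)
Lemma level_singularM k i (u v : tmon (iter_wr T k)) :
  level_singular i (mmul u v) -> level_singular i (if invertible u then v else u).
Proof.
elim: k u v => [|k IHk] u v /=.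
  by rewrite invertibleM; case u_inv: (invertible u); rewrite ?u_inv.
rewrite (invertible_wr u).
have u1v1 : [forall x, invertible ((wr_mul u v).1 x)] =
    [forall x, invertible (u.1 x) && invertible (v.1 (tact x u.2))].
  by apply: eq_forallb => x; rewrite ffunE invertibleM.
have v1E : invertible u.2 -> [forall x, invertible (v.1 (tact x u.2))] =
    [forall x, invertible (v.1 x)].
  move/invertibleP=> u2; apply/forallP/forallP=> v1 x; last exact: v1.
  by rewrite -(f_invF u2 x).
have split_u1v1 : [forall x, invertible ((wr_mul u v).1 x)] =
    [forall x, invertible (u.1 x)] && [forall x, invertible (v.1 (tact x u.2))].
  rewrite u1v1; apply/forallP/andP=> [uv|[/forallP u1 /forallP v1] x].
    by split; apply/forallP=> x; case/andP: (uv x).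
  by rewrite u1 v1.
case: eqP => _; rewrite split_u1v1.
  rewrite invertibleM => /andP[/andP[u2 v2]]; rewrite (v1E u2) u2 /= negb_and.
  by case: ifP => u1 /=; rewrite ?v2 ?u2 ?u1.
case/andP=> /IHk uv2 /andP[u1 v1]; rewrite u1 andbT.
by case: ifP uv2 => u2 /= ->; rewrite // -v1E.
Qed.

Lemma level_singular_inj k i j (u : tmon (iter_wr T k)) : i <= k -> j <= k ->
  level_singular i u -> level_singular j u -> i = j.
Proof.
elim: k u => [|k IHk] u; first by rewrite !leqn0 => /eqP-> /eqP->.
rewrite leq_eqVlt ltnS [j <= _]leq_eqVlt ltnS /= => le_i le_j.
case: eqP le_i => [->|_] /= le_i; case: eqP le_j => [->|_] //= le_j.
- by case/andP=> _ /negPf->; rewrite andbF.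
- by case/andP=> _ ->; rewrite andbF.
by case/andP=> ui _ /andP[uj _]; apply: IHk ui uj.
Qed.

Lemma level_singular_ex k i : i <= k -> is_full (T i) -> 1 < #|pt (T i)| ->
  exists u : tmon (iter_wr T k), level_singular i u.
Proof.
move=> le_ik Ti_full Xi_gt1; elim: k le_ik => [|k IHk].
  by rewrite leqn0 => /eqP i0; move: Ti_full Xi_gt1; rewrite i0; apply: full_noninvertible.
rewrite leq_eqVlt ltnS => /predU1P[ik|le_ik].
  move: Ti_full Xi_gt1; rewrite ik => /full_noninvertible/[apply] -[r r_ninv].
  have /card_gt0P[x0 _] := pt_gt0 (iter_wr T k).
  exists ([ffun _ => r], mone); rewrite /= eqxx invertible1 /=.
  by apply/forallPn; exists x0; rewrite ffunE.
have [u ui] := IHk le_ik; exists ([ffun _ => mone], u) => /=.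
rewrite ltn_eqF // ui /=; apply/forallP=> x; rewrite ffunE; exact: invertible1.
Qed.

End Levels.

(** * Counting generators: units by signs, non-units by singular levels *)

Lemma generates_card (M : finMonoid) (n : nat) (J : {set 'I_n})
    (inv : M -> bool) (sg sing : 'I_n -> M -> bool) (U : {set M}) :
    inv mone -> (forall x y, inv (mmul x y) = inv x && inv y) ->
    (forall i x y, inv x -> inv y -> sg i (mmul x y) = sg i x (+) sg i y) ->
    (forall c : {ffun 'I_n -> bool}, exists2 x, inv x & forall i, sg i x = c i) ->
    (forall i x, sing i x -> ~~ inv x) ->
    (forall i x y, sing i (mmul x y) -> sing i (if inv x then y else x)) ->
    (forall i j x, sing i x -> sing j x -> i = j) ->
    (forall i, i \in J -> exists x, sing i x) ->
  generates U -> n + #|J| <= #|U|.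
Proof.
move=> inv1 invM sgM sg_onto sing_ninv singM sing_inj sing_ex genU.
pose A := [set u in U | inv u]; rewrite -(cardsID A U) leq_add //; last first.
  (* Picks a generator singular at level [i]; one occurs in any word for a singular element, and
     distinct levels give distinct choices. *)
  pose g i := odflt mone [pick u in U | sing i u].
  have gP i : i \in J -> (g i \in U) /\ sing i (g i).
    case/sing_ex=> x; have [s [sU ->]] := genU x => sing_s.
    rewrite /g; case: pickP => [u /andP[] //|noU].
    suff: ~~ sing i (\big[mmul/mone]_(u <- s) u) by rewrite sing_s.
    elim: s sU {sing_s} => [|u s IHs] sU.
      by rewrite big_nil; apply: contraL inv1 => /sing_ninv.
    have uU : u \in U by apply: sU; rewrite mem_head.
    rewrite big_cons; apply/negP=> /singM; case: ifP => _; apply/negP.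
      by rewrite IHs // => v vs; apply: sU; rewrite inE vs orbT.
    by move: (noU u); rewrite uU => /= ->.
  rewrite -(card_in_imset (f := g)) => [|i j Ji Jj gij].
    apply/subset_leq_card/subsetP=> _ /imsetP[i /gP[gU /sing_ninv g_ninv] ->].
    by rewrite !inE gU negb_and g_ninv orbT.
  by have [_ gi] := gP i Ji; have [_] := gP j Jj; rewrite -gij; apply: sing_inj gi.
(* The signs of a word in units depend only on the set [B] of letters occurring an odd number of
   times. All 2^n sign vectors thus come from subsets of [A], whence n is at most [#|A|]. *)
pose f (B : {set M}) := [ffun i => \big[addb/false]_(u in B) sg i u].
have sg1 i : sg i mone = false.
  by have := sgM i _ _ inv1 inv1; rewrite Monoid.mul1m; case: (sg i mone).
have setIA : U :&: A = A by apply/setIidPr/subsetP=> u; rewrite inE => /andP[].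
have : [set: {ffun 'I_n -> bool}] \subset f @: powerset A.
  apply/subsetP=> c _; have [x] := sg_onto c.
  have [s [sU ->]] := genU x => inv_s sg_s.
  suff [B BA fB] : exists2 B : {set M}, B \subset A &
      forall i, sg i (\big[mmul/mone]_(u <- s) u) = f B i.
    apply/imsetP; exists B; first by rewrite powersetE.
    by apply/ffunP=> i; rewrite -fB.
  elim: s sU inv_s {sg_s} => [|u s IHs] sU.
    by exists set0; rewrite ?sub0set // => i; rewrite big_nil ffunE big_set0.
  rewrite big_cons invM => /andP[inv_u inv_s].
  have [v vs|//|B BA fB] := IHs; first by apply: sU; rewrite inE vs orbT.
  have uA : u \in A by rewrite inE inv_u sU ?mem_head.
  have [uB|uB] := boolP (u \in B).
    exists (B :\ u) => [|i]; first by apply: subset_trans BA; apply: subsetDl.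
    rewrite sgM // fB !ffunE (big_setD1 u) //= addbA addbb addFb //.
  exists (u |: B) => [|i]; first by rewrite subUset sub1set uA.
  by rewrite sgM // fB !ffunE big_setU1.
move/subset_leq_card; rewrite cardsT card_ffun card_bool card_ord => le_f.
rewrite setIA -(leq_exp2l _ _ (ltnSn 1)) (leq_trans le_f) //.
by rewrite -card_powerset leq_imset_card.
Qed.

(** * The two bounds combined for the iterated wreath product *)

Theorem theorem1p1 (n : nat) (T : nat -> transMonoid)
    (n_ge2 : 2 <= n)
    (X_ge2 : forall i, i < n -> 2 <= #|pt (T i)|)
    (T_full_or_sym : forall i, i < n -> is_full (T i) \/ is_sym (T i)) :
  rank (tmon (iter_wr T n.-1)) = n + #|[set i : 'I_n | is_full (T i)]|.
Proof.
case: n n_ge2 X_ge2 T_full_or_sym => // k k_gt0 X_gt1 T_rich /=.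
have count : #|[set i : 'I_k.+1 | is_full (T i)]| = \sum_(i < k.+1) is_full (T i).
  rewrite -sum1_card big_mkcond; apply: eq_bigr => i _; rewrite inE.
  by case: (is_full _).
apply/eqP; rewrite eqn_leq; apply/andP; split.
  rewrite count; have [_ _] := iter_wr_upper X_gt1 T_rich.
  rewrite (k_gt0 : 0 < k) => /(_ isT)[s gen_s sz_s].
  exact: leq_trans (rank_le_size gen_s) sz_s.
clear count; have [[U genU <-] _] := rankP (tmon (iter_wr T k)).
apply: (generates_card (inv := @invertible _)
  (sg := fun i : 'I_k.+1 => level_sign i) (sing := fun i : 'I_k.+1 => level_singular i)) genU.
- exact: invertible1.
- exact: invertibleM.
- by move=> i u v; apply: level_signM.
- move=> c; have [u u_inv uc] := level_sign_onto (fun i => c (inord i)) X_gt1 T_rich.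
  by exists u => // i; rewrite uc ?inord_val // -ltnS.
- by move=> i u; apply: level_singular_noninv.
- by move=> i u v; apply: level_singularM.
- move=> i j u ui uj; apply: val_inj.
  by apply: level_singular_inj ui uj; rewrite -ltnS.
- move=> i; rewrite inE => Ti; have le_ik : i <= k by rewrite -ltnS.
  by apply: level_singular_ex Ti (X_gt1 _ _).
Qed.
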